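(* Let $\mathbb{K}$ be a field of characteristic $0$ and let $(A,\mu,\alpha)$ be a hom-associative algebra over $\mathbb{K}$. For all $m,n\ge1$, $f\in C^m_\alpha(A,A)$ and $g\in C^n_\alpha(A,A)$, $$\delta_\alpha(f\cup_\alpha g)=\delta_\alpha f\cup_\alpha g+(-1)^m f\cup_\alpha\delta_\alpha g.$$
   Context: Hom-associative algebra (always assumed multiplicative): a triple $(A,\mu,\alpha)$ of a vector space $A$, a bilinear map $\mu:A\times A\to A$ and a linear map $\alpha:A\to A$ with $\mu(\alpha(a),\mu(b,c))=\mu(\mu(a,b),\alpha(c))$ and $\alpha(\mu(a,b))=\mu(\alpha(a),\alpha(b))$ for all $a,b,c\in A$. For $n\ge1$, $C^n_\alpha(A,A)$ is the space of multilinear maps $f:A^{\otimes n}\to A$ with $\alpha\circ f=f\circ\alpha^{\otimes n}$. The coboundary $\delta_\alpha:C^n_\alpha(A,A)\to C^{n+1}_\alpha(A,A)$ is $$(\delta_\alpha f)(a_1,\dots,a_{n+1})=\mu(\alpha^{n-1}(a_1),f(a_2,\dots,a_{n+1}))+\sum_{i=1}^n(-1)^i f(\alpha(a_1),\dots,\alpha(a_{i-1}),\mu(a_i,a_{i+1}),\alpha(a_{i+2}),\dots,\alpha(a_{n+1}))+(-1)^{n+1}\mu(f(a_1,\dots,a_n),\alpha^{n-1}(a_{n+1})).$$ Cup product: for $f\in C^m_\alpha(A,A)$, $g\in C^n_\alpha(A,A)$, $f\cup_\alpha g\in C^{m+n}_\alpha(A,A)$ is $$(f\cup_\alpha g)(a_1,\dots,a_{m+n})=\mu\big(f(\alpha^{n-1}a_1,\dots,\alpha^{n-1}a_m),\,g(\alpha^{m-1}a_{m+1},\dots,\alpha^{m-1}a_{m+n})\big).$$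 *)

(* Defs.v *)
From HB Require Import structures.
From mathcomp Require Import all_boot all_algebra.

Set Implicit Arguments.
Unset Strict Implicit.
Unset Printing Implicit Defensive.

Import GRing.Theory.
Local Open Scope ring_scope.

(* Arbitrary, possibly infinite, dimension: the carrier is only an lmodType. *)
Record homAssoc (K : fieldType) := HomAssoc {
  ha_sort :> lmodType K;
  hmu : {bilinear ha_sort -> ha_sort -> ha_sort};
  halpha : {linear ha_sort -> ha_sort};
  hmuA : forall a b c : ha_sort,
    hmu (halpha a) (hmu b c) = hmu (hmu a b) (halpha c);
  halphaM : forall a b : ha_sort,
    halpha (hmu a b) = hmu (halpha a) (halpha b)
}.

Arguments hmu {K h}.
Arguments halpha {K h}.

Section Multilinear.
Variables (K : fieldType) (V W : lmodType K).

Definition set_arg n (a : {ffun 'I_n -> V}) (i : 'I_n) (x : V) :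
    {ffun 'I_n -> V} :=
  [ffun j => if j == i then x else a j].

Definition multilinear n (f : {ffun 'I_n -> V} -> W) : Prop :=
  forall (a : {ffun 'I_n -> V}) (i : 'I_n), linear (fun x => f (set_arg a i x)).

Lemma multilinear_slot n (f : {ffun 'I_n -> V} -> W) (k : 'I_n)
    (F : V -> {ffun 'I_n -> V}) :
  multilinear f ->
  (forall j, j != k -> forall x y, F x j = F y j) ->
  linear (fun x => F x k) ->
  linear (fun x => f (F x)).
Proof.
move=> fL Fcst Flin c x y.
have E z : F z = set_arg (F 0) k (F z k).
  by apply/ffunP=> j; rewrite ffunE; case: eqVneq => [->|/Fcst].
by rewrite E Flin fL -!E.
Qed.

End Multilinear.

Section Cochains.
Variables (K : fieldType) (A : homAssoc K).

(* [cochain n] is C^n_alpha(A, A) for n >= 1; n = 0 is junk. *)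
Record cochain (n : nat) := Cochain {
  cochain_fun :> {ffun 'I_n -> A} -> A;
  cochain_multilinear : multilinear cochain_fun;
  cochain_alpha : forall a : {ffun 'I_n -> A},
    halpha (cochain_fun a) = cochain_fun [ffun i => halpha (a i)]
}.

Definition alphaX (k : nat) (x : A) : A := iter k halpha x.

Lemma alphaX_linear k : linear (alphaX k).
Proof. by move=> c x y; elim: k => //= k ->; rewrite linearP. Qed.

Lemma alphaX_alpha k x : alphaX k (halpha x) = halpha (alphaX k x).
Proof. by rewrite /alphaX -iterSr. Qed.

(* 0-based positions: slot i receives mu (a_i, a_(i+1)), the slots before it
   alpha (a_j), the slots after it alpha (a_(j+1)). *)
Definition contract n (i : 'I_n) (a : {ffun 'I_n.+1 -> A}) : {ffun 'I_n -> A} :=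
  [ffun j : 'I_n =>
    if (j < i)%N then halpha (a (widen_ord (leqnSn n) j))
    else if j == i then hmu (a (widen_ord (leqnSn n) i)) (a (lift ord0 i))
    else halpha (a (lift ord0 j))].

Definition behead_args n (a : {ffun 'I_n.+1 -> A}) : {ffun 'I_n -> A} :=
  [ffun j : 'I_n => a (lift ord0 j)].

Definition belast_args n (a : {ffun 'I_n.+1 -> A}) : {ffun 'I_n -> A} :=
  [ffun j : 'I_n => a (widen_ord (leqnSn n) j)].

(* The sign at the 0-based index i is (-1)^(i+1). *)
Definition delta_fun n (f : {ffun 'I_n -> A} -> A) (a : {ffun 'I_n.+1 -> A}) : A :=
  hmu (alphaX n.-1 (a ord0)) (f (behead_args a))
  + \sum_(i < n) (-1) ^+ i.+1 *: f (contract i a)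
  + (-1) ^+ n.+1 *: hmu (f (belast_args a)) (alphaX n.-1 (a ord_max)).

Definition cup_fun m n (f : {ffun 'I_m -> A} -> A) (g : {ffun 'I_n -> A} -> A)
    (a : {ffun 'I_(m + n) -> A}) : A :=
  hmu (f [ffun i : 'I_m => alphaX n.-1 (a (lshift n i))])
      (g [ffun j : 'I_n => alphaX m.-1 (a (rshift m j))]).

Lemma add_linear (F G : A -> A) :
  linear F -> linear G -> linear (fun x => F x + G x).
Proof.
by move=> FL GL c x y; rewrite FL GL scalerDr !addrA; congr (_ + _); rewrite addrAC.
Qed.

Lemma scale_linear (d : K) (F : A -> A) :
  linear F -> linear (fun x => d *: F x).
Proof. by move=> FL c x y; rewrite FL scalerDr !scalerA mulrC. Qed.

Lemma sum_linear n (F : 'I_n -> A -> A) :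
  (forall i, linear (F i)) -> linear (fun x => \sum_(i < n) F i x).
Proof.
move=> FL c x y; rewrite scaler_sumr -big_split /=.
by apply: eq_bigr => i _; rewrite FL.
Qed.

Lemma linear_mul_constr (F G : A -> A) :
  linear F -> (forall x y, G x = G y) -> linear (fun x => hmu (F x) (G x)).
Proof.
by move=> FL Gc c x y; rewrite FL linearPl (Gc _ 0) (Gc x 0) (Gc y 0).
Qed.

Lemma linear_mul_constl (F G : A -> A) :
  (forall x y, F x = F y) -> linear G -> linear (fun x => hmu (F x) (G x)).
Proof.
by move=> Fc GL c x y; rewrite GL linearPr (Fc _ 0) (Fc x 0) (Fc y 0).
Qed.

Lemma behead_set0 n (a : {ffun 'I_n.+1 -> A}) x :
  behead_args (set_arg a ord0 x) = behead_args a.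
Proof. by apply/ffunP=> j; rewrite !ffunE. Qed.

Lemma delta_multilinear n (f : cochain n) : multilinear (delta_fun f).
Proof.
move=> a i; rewrite /delta_fun.
have fL := @cochain_multilinear n f.
apply: add_linear; [apply: add_linear|].
- case: (unliftP ord0 i) => [k|] ->.
    apply: linear_mul_constl => [x y|]; first by rewrite !ffunE.
    apply: (multilinear_slot (k := k)) => // [j jk x y|c x y].
      by rewrite !ffunE (inj_eq lift_inj) (negPf jk).
    by rewrite !ffunE eqxx.
  apply: linear_mul_constr => [c x y|x y]; last by rewrite !behead_set0.
  by rewrite !ffunE eqxx; apply: alphaX_linear.
- apply: sum_linear => k; apply: scale_linear.
  have [ik|ki] := ltnP k i; last first.
    have ltin : (i < n)%N by apply: leq_ltn_trans ki _.
    apply: (multilinear_slot (k := Ordinal ltin)) => //.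
      move=> j ji x y; rewrite !ffunE -!val_eqE /=.
      have ji' : (j != i :> nat) by exact: ji.
      rewrite /bump /= (negPf ji').
      case: ltnP => // kj; case: eqVneq => [jk|_].
        by rewrite !gtn_eqF ?ltnS // -jk ltn_neqAle eq_sym ji' jk.
      by rewrite !gtn_eqF // add1n ltnS (leq_trans ki).
    move=> c x y; rewrite !ffunE -!val_eqE /= /bump /= add1n.
    case: ltnP => [ltik|leki]; first by rewrite eqxx linearP.
    have eik : (i == k :> nat) by rewrite eqn_leq ki leki.
    have eki : (k == i :> nat) by rewrite eq_sym.
    have nki : (k.+1 == i :> nat) = false by rewrite (eqP eik) gtn_eqF.
    by rewrite eik eki nki linearPl.
  case: (unliftP ord0 i) ik => [k'|] -> //= kk'.
  rewrite /bump /= add1n ltnS in kk'.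
  apply: (multilinear_slot (k := k')) => //.
    move=> j jk' x y; rewrite !ffunE -!val_eqE /= /bump /= !add1n !eqSS.
    have jk : (j != k' :> nat) by exact: jk'.
    case: ltnP => [jltk|kj].
      by rewrite !ltn_eqF // ltnS (leq_trans (ltnW jltk)).
    case: eqVneq => [ejk|_]; last by rewrite (negPf jk).
    by rewrite -ejk (negPf jk) ltn_eqF // ltnS ejk.
  move=> c x y; rewrite !ffunE -!val_eqE /= /bump /= !add1n !eqSS.
  rewrite ltnNge kk' /= eqxx.
  case: eqVneq => [ek|_]; last by rewrite linearP.
  by rewrite -ek ltn_eqF // linearPr.
- apply: scale_linear.
  case: (unliftP ord_max i) => [k|] ->.
    have wl : lift ord_max k = widen_ord (leqnSn n) k.
      by apply/ord_inj; rewrite lift_max.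
    rewrite wl; apply: linear_mul_constr => [|x y]; last first.
      by rewrite !ffunE -!val_eqE /= gtn_eqF.
    apply: (multilinear_slot (k := k)) => // [j jk x y|c x y].
      by rewrite !ffunE -!val_eqE /= val_eqE (negPf jk).
    by rewrite !ffunE -!val_eqE /= eqxx.
  apply: linear_mul_constl => [x y|c x y].
    by congr (f _); apply/ffunP=> j; rewrite !ffunE -!val_eqE /= ltn_eqF.
  by rewrite !ffunE eqxx; apply: alphaX_linear.
Qed.

Lemma delta_alpha n (f : cochain n) (a : {ffun 'I_n.+1 -> A}) :
  halpha (delta_fun f a) = delta_fun f [ffun i => halpha (a i)].
Proof.
rewrite /delta_fun !linearD linear_sum linearZZ !halphaM !ffunE !alphaX_alpha.
rewrite !cochain_alpha; congr (_ + _ + _).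
- by congr (hmu _ (f _)); apply/ffunP=> j; rewrite !ffunE.
- apply: eq_bigr => i _; rewrite linearZZ cochain_alpha; congr (_ *: f _).
  by apply/ffunP=> j; rewrite !ffunE; case: ifP => // _; case: ifP; rewrite ?halphaM.
- by congr (_ *: hmu (f _) _); apply/ffunP=> j; rewrite !ffunE.
Qed.

Definition delta n (f : cochain n) : cochain n.+1 :=
  Cochain (delta_multilinear f) (delta_alpha f).

Lemma cup_multilinear m n (f : cochain m) (g : cochain n) :
  multilinear (cup_fun f g).
Proof.
move=> a i; rewrite /cup_fun.
have fL := @cochain_multilinear m f; have gL := @cochain_multilinear n g.
rewrite -(splitK i); case: (split i) => k /=.
  apply: linear_mul_constr => [|x y]; last first.
    by congr (g _); apply/ffunP=> j; rewrite !ffunE eq_rlshift.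
  apply: (multilinear_slot (k := k)) => // [j jk x y|c x y].
    by rewrite !ffunE eq_lshift (negPf jk).
  by rewrite !ffunE eqxx; apply: alphaX_linear.
apply: linear_mul_constl => [x y|].
  by congr (f _); apply/ffunP=> j; rewrite !ffunE eq_lrshift.
apply: (multilinear_slot (k := k)) => // [j jk x y|c x y].
  by rewrite !ffunE eq_rshift (negPf jk).
by rewrite !ffunE eqxx; apply: alphaX_linear.
Qed.

Lemma cup_alpha m n (f : cochain m) (g : cochain n)
    (a : {ffun 'I_(m + n) -> A}) :
  halpha (cup_fun f g a) = cup_fun f g [ffun i => halpha (a i)].
Proof.
rewrite /cup_fun halphaM !cochain_alpha.
by congr (hmu (f _) (g _)); apply/ffunP=> j; rewrite !ffunE alphaX_alpha.
Qed.

Definition cup m n (f : cochain m) (g : cochain n) : cochain (m + n) :=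
  Cochain (cup_multilinear f g) (cup_alpha f g).

Definition cast_args n n' (e : n = n') (a : {ffun 'I_n' -> A}) :
    {ffun 'I_n -> A} :=
  [ffun j : 'I_n => a (cast_ord e j)].

End Cochains.

(* Main.v *)
Require Import Defs.
From mathcomp Require Import all_boot all_algebra.

Set Implicit Arguments.
Unset Strict Implicit.
Unset Printing Implicit Defensive.

Import GRing.Theory.
Local Open Scope ring_scope.

(** The coboundary of an [n]-cochain is an alternating sum of [n + 2] faces: an
    outer face multiplying by the first argument, an inner face for each
    product of two neighbours, and an outer face multiplying by the last
    argument.  The faces of [f \cup g] are all accounted for by those of [f]
    and of [g].  A product taken among the first [m + 1] arguments is an inner
    face of [f], the other ones are inner faces of [g]
    ([face_in_cup_left], [face_in_cup_right]).  Hom-associativity moves the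
    multiplication by the first argument inside the left factor
    ([face_first_cup]), and the multiplication by the last argument inside the
    right one ([face_last_cup]).

    The two faces left over on the right-hand side, the last one of [f] and the
    first one of [g], both multiply the values of [f] and [g] by the argument
    standing between them, the one of index [m] counted from [0].  They are the two bracketings of the same
    triple product, hence equal ([face_last_cup_face_first]), and they occur
    with the opposite signs [(-1)^(m+1)] and [(-1)^m].

    The powers of [alpha] agree for the following reason.  A face of [f] is a
    cochain of degree one higher, so in its cup product with [g] the arguments
    of [g] are twisted once more than in [f \cup g].  For an inner face this
    extra twist is the one put on the arguments away from the product; for an
    outer face it is the one that hom-associativity transfers to the value of
    [g], and so to its arguments, as [g] commutes with [alpha].  The same holds
    with [f] and [g] exchanged. *)

Section CupLeibniz.
Variables (K : fieldType) (A : homAssoc K).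

Definition face_first n (f : {ffun 'I_n -> A} -> A) (a : {ffun 'I_n.+1 -> A}) : A :=
  hmu (alphaX n.-1 (a ord0)) (f (behead_args a)).

Definition face_in n (i : 'I_n) (f : {ffun 'I_n -> A} -> A)
    (a : {ffun 'I_n.+1 -> A}) : A :=
  f (contract i a).

Definition face_last n (f : {ffun 'I_n -> A} -> A) (a : {ffun 'I_n.+1 -> A}) : A :=
  hmu (f (belast_args a)) (alphaX n.-1 (a ord_max)).

Lemma delta_funE n (f : {ffun 'I_n -> A} -> A) a :
  delta_fun f a = face_first f a + \sum_(i < n) (-1) ^+ i.+1 *: face_in i f a
                  + (-1) ^+ n.+1 *: face_last f a.
Proof. by []. Qed.

Lemma alphaXD i j (x : A) : alphaX i (alphaX j x) = alphaX (i + j) x.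
Proof. by rewrite /alphaX iterD. Qed.

Lemma alphaX_mul k (x y : A) : alphaX k (hmu x y) = hmu (alphaX k x) (alphaX k y).
Proof. by elim: k => //= k ->; rewrite halphaM. Qed.

Lemma pred_addn m n : (0 < m)%N -> (0 < n)%N -> (m + n).-1 = (m.-1 + n.-1).+1.
Proof. by case: m n => // m [] // n; rewrite addnS. Qed.

Lemma cup_delta_left m n (f : {ffun 'I_m -> A} -> A) (g : {ffun 'I_n -> A} -> A) a :
  cup_fun (delta_fun f) g a =
    cup_fun (face_first f) g a
    + \sum_(i < m) (-1) ^+ i.+1 *: cup_fun (face_in i f) g a
    + (-1) ^+ m.+1 *: cup_fun (face_last f) g a.
Proof.
rewrite /cup_fun delta_funE !linearDl linearZl_LR linear_sumlz.
by congr (_ + _ + _); apply: eq_bigr => i _; rewrite linearZl_LR.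
Qed.

Lemma cup_delta_right m n (f : {ffun 'I_m -> A} -> A) (g : {ffun 'I_n -> A} -> A) a :
  cup_fun f (delta_fun g) a =
    cup_fun f (face_first g) a
    + \sum_(i < n) (-1) ^+ i.+1 *: cup_fun f (face_in i g) a
    + (-1) ^+ n.+1 *: cup_fun f (face_last g) a.
Proof.
rewrite /cup_fun delta_funE !linearDr linearZr_LR linear_sumr.
by congr (_ + _ + _); apply: eq_bigr => i _; rewrite linearZr_LR.
Qed.

Section Faces.
Variables (m n : nat) (f : cochain A m) (g : cochain A n).
Hypotheses (m_gt0 : (0 < m)%N) (n_gt0 : (0 < n)%N).
Implicit Type a : {ffun 'I_(m + n).+1 -> A}.

Lemma face_first_cup a :
  face_first (cup_fun f g) a = cup_fun (face_first f) g (cast_args (addSn m n) a).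
Proof.
rewrite /face_first /cup_fun pred_addn // [alphaX _.+1 _]/= hmuA cochain_alpha !ffunE alphaXD.
congr (hmu (hmu (alphaX _ (a _)) (f _)) (g _)).
- exact: val_inj.
- by apply/ffunP=> j; rewrite !ffunE; congr (alphaX _ (a _)); apply: val_inj.
- apply/ffunP=> j; rewrite !ffunE -[halpha _]/(alphaX m.-1.+1 _) prednK //.
  by congr (alphaX _ (a _)); apply: val_inj.
Qed.

Lemma face_last_cup a :
  face_last (cup_fun f g) a = cup_fun f (face_last g) (cast_args (addnS m n) a).
Proof.
rewrite /face_last /cup_fun pred_addn // [(m.-1 + _)%N]addnC.
rewrite [alphaX _.+1 _]/= -hmuA cochain_alpha !ffunE alphaXD.
congr (hmu (f _) (hmu (g _) (alphaX _ (a _)))).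
- apply/ffunP=> j; rewrite !ffunE -[halpha _]/(alphaX n.-1.+1 _) prednK //.
  by congr (alphaX _ (a _)); apply: val_inj.
- by apply/ffunP=> j; rewrite !ffunE; congr (alphaX _ (a _)); apply: val_inj.
- exact: val_inj.
Qed.

(** The two bracketings of a product of [f], the middle argument and [g].  The
    extra twist is on the arguments of [g] on the left and on those of [f] on
    the right, as hom-associativity requires; the middle argument is twisted
    [m + n - 2] times on both sides. *)
Lemma face_last_cup_face_first a :
  cup_fun (face_last f) g (cast_args (addSn m n) a)
  = cup_fun f (face_first g) (cast_args (addnS m n) a).
Proof.
rewrite /face_last /face_first /cup_fun !ffunE !alphaXD.
have -> : [ffun j => alphaX m.+1.-1 (cast_args (addSn m n) a (rshift m.+1 j))]
  = [ffun j : 'I_n => halpha ([ffun j => alphaX m.-1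
       (cast_args (addSn m n) a (rshift m.+1 j))] j)].
  by apply/ffunP=> j; rewrite !ffunE -[RHS]/(alphaX m.-1.+1 _) prednK.
rewrite -cochain_alpha -hmuA cochain_alpha.
congr (hmu (f _) (hmu _ (g _))).
- apply/ffunP=> j; rewrite !ffunE -[LHS]/(alphaX n.-1.+1 _) prednK //.
  by congr (alphaX _ (a _)); apply: val_inj.
- by rewrite [(n.-1 + _)%N]addnC;
    congr (alphaX _ (a _)); apply: val_inj; rewrite /= addn0.
- apply/ffunP=> j; rewrite !ffunE; congr (alphaX _ (a _)).
  by apply: val_inj; rewrite /= /bump /= addnS.
Qed.

Lemma face_in_cup_left (i : 'I_m) a :
  face_in (lshift n i) (cup_fun f g) a =
    cup_fun (face_in i f) g (cast_args (addSn m n) a).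
Proof.
rewrite /face_in /cup_fun; congr (hmu (f _) (g _)); apply/ffunP=> j; rewrite !ffunE /=.
- have -> : (lshift n j == lshift n i) = (j == i) by rewrite eq_lshift.
  case: ifP => _; last case: ifP => _; rewrite -?alphaX_alpha ?alphaX_mul.
  + by congr (alphaX _ (halpha (a _))); apply: val_inj.
  + by congr (hmu (alphaX _ (a _)) (alphaX _ (a _))); apply: val_inj.
  + by congr (alphaX _ (halpha (a _))); apply: val_inj.
- have im := ltn_ord i.
  rewrite eq_rlshift ltnNge (leq_trans (ltnW im) (leq_addr _ _)) /=.
  rewrite alphaX_alpha -[LHS]/(alphaX m.-1.+1 _) prednK //.
  by congr (alphaX _ (a _)); apply: val_inj.
Qed.

Lemma face_in_cup_right (i : 'I_n) a :
  face_in (rshift m i) (cup_fun f g) a =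
    cup_fun f (face_in i g) (cast_args (addnS m n) a).
Proof.
rewrite /face_in /cup_fun; congr (hmu (f _) (g _)); apply/ffunP=> j; rewrite !ffunE /=.
- rewrite (leq_trans (ltn_ord j) (leq_addr _ _)).
  rewrite alphaX_alpha -[LHS]/(alphaX n.-1.+1 _) prednK //.
  by congr (alphaX _ (a _)); apply: val_inj.
- rewrite ltn_add2l eq_rshift.
  case: ifP => _; last case: ifP => _; rewrite -?alphaX_alpha ?alphaX_mul.
  + by congr (alphaX _ (halpha (a _))); apply: val_inj.
  + congr (hmu (alphaX _ (a _)) (alphaX _ (a _))); apply: val_inj => //.
    by rewrite /= /bump /= !add1n addnS.
  + by congr (alphaX _ (halpha (a _))); apply: val_inj;
      rewrite /= /bump /= !add1n addnS.
Qed.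

End Faces.

End CupLeibniz.

Theorem proposition5p2 (K : fieldType) (hK : [pchar K] =i pred0)
    (A : homAssoc K) (m n : nat) (hm : (0 < m)%N) (hn : (0 < n)%N)
    (f : cochain A m) (g : cochain A n) (a : {ffun 'I_(m + n).+1 -> A}) :
  delta (cup f g) a =
    cup (delta f) g (cast_args (addSn m n) a)
    + (-1) ^+ m *: cup f (delta g) (cast_args (addnS m n) a).
Proof.
rewrite /= delta_funE cup_delta_left cup_delta_right.
rewrite face_first_cup // face_last_cup // face_last_cup_face_first //.
have signM k : (-1) ^+ (m + k).+1 = (-1) ^+ m * (-1) ^+ k.+1 :> K.
  by rewrite -addnS exprD.
rewrite big_split_ord /=.
under eq_bigr do rewrite face_in_cup_left //.
under [X in _ + (_ + X) + _]eq_bigr do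
  rewrite face_in_cup_right // signM -scalerA.
rewrite -scaler_sumr signM -scalerA !scalerDr.
(* The last face of [f] and the first face of [g] cancel. *)
by rewrite [(-1) ^+ m.+1]exprS mulN1r scaleNr !addrA addrNK.
Qed.
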